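(* Let $n\geq 1$. The monoid $\mathcal{IO}_n^+$ is defined by the monoid presentation $\langle B\mid R^+\rangle$ on $n-1$ generators and $\frac{1}{2}(n^2-n)$ relations, where $B=\{b_1,\ldots,b_{n-1}\}$ is an alphabet with $n-1$ letters and $R^+$ is the following set of relations on $B^*$: $(R_3)$ $b_ib_1=b_i$, for $1\leq i\leq n-1$; $(R_4)$ $b_ib_{j+1}=b_{j+1}b_{i+1}$, for $1\leq i\leq j\leq n-2$.
   Context: Let $\Omega_n=\{1,\ldots,n\}$ with the usual linear order. Transformations of $\Omega_n$ are written on the right of their arguments and composed from left to right: $x(\alpha\beta)=(x\alpha)\beta$. $\mathcal{IO}_n$ is the monoid, under composition, of all full transformations $\alpha:\Omega_n\to\Omega_n$ that are order-preserving ($x\leq y$ implies $x\alpha\leq y\alpha$) and whose image is an interval of $\Omega_n$ (if $x\leq y\leq z$ and $x,z\in\mathrm{Im}(\alpha)$ then $y\in\mathrm{Im}(\alpha)$). $\mathcal{IO}_n^+$ is the submonoid of those $\alpha\in\mathcal{IO}_n$ with $x\leq x\alpha$ for all $x\in\Omega_n$. A monoid presentation $\langle C\mid S\rangle$ consists of an alphabet $C$ and a set $S\subseteq C^*\times C^*$ of relations on the free monoid $C^*$, a pair $(u,v)$ being written $u=v$; $\sim_S$ denotes the smallest congruence on $C^*$ containing $S$. A monoid $M$ is defined by the presentation $\langle C\mid S\rangle$ if $M$ is isomorphic to $C^*/\sim_S$. (In this result the letter $b_i$ represents the transformation of $\Omega_n$ with $xb_i=x+1$ for $x\leq i$ and $xb_i=x$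 for $x\geq i+1$. For $n=1$ the alphabet and the set of relations are empty.) *)

(* Defs.v *)
From HB Require Import structures.
From mathcomp Require Import all_boot.
From mathcomp Require Import boolp classical_sets cardinality.

Set Implicit Arguments.
Unset Strict Implicit.
Unset Printing Implicit Defensive.

Local Open Scope classical_set_scope.
Local Open Scope group_scope.
Local Open Scope quotient_scope.

(* The monoid C^* of words over C, under concatenation. *)
Definition free_monoid (C : Type) : Type := seq C.

Section FreeMonoid.
Variable C : choiceType.

HB.instance Definition _ := Choice.copy (free_monoid C) (seq C).

HB.instance Definition _ :=
  isMonoid.Build (free_monoid C) (@catA C) (@cat0s C) (@cats0 C).

End FreeMonoid.

Definition congruence (M : monoidType) (e : M -> M -> Prop) : Prop :=
  [/\ forall u, e u u,
      forall u v, e u v -> e v u,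
      forall u v w, e u v -> e v w -> e u w
    & forall u u' v v', e u u' -> e v v' -> e (u * v) (u' * v')].

(* The smallest congruence containing S, as the intersection of all the
   congruences containing S. *)
Definition generated_congruence (M : monoidType) (S : set (M * M))
    (u v : M) : Prop :=
  forall e : M -> M -> Prop,
    congruence e -> (forall p, S p -> e p.1 p.2) -> e u v.

Lemma generated_congruenceP (M : monoidType) (S : set (M * M)) :
  congruence (generated_congruence S).
Proof.
split=> [u e [er _ _ _] _ | u v uv e | u v w uv vw e | u u' v v' uu' vv' e].
- exact: er.
- by move=> ce Se; case: (ce) => _ es _ _; apply: es; exact: uv.
- move=> ce Se; case: (ce) => _ _ et _.
  by apply: (et _ v); [apply: uv | apply: vw].
- by move=> ce Se; case: (ce) => _ _ _ em; apply: em; [apply: uu' | apply: vv'].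
Qed.

Section Presentation.
Variables (C : choiceType) (S : set (free_monoid C * free_monoid C)).

Let W : monoidType := free_monoid C.

Definition presentation_rel : rel W :=
  fun u v => `[< generated_congruence S u v >].

Lemma presentation_rel_refl : reflexive presentation_rel.
Proof. by case: (generated_congruenceP S) => r _ _ _ u; apply/asboolP; exact: r. Qed.

Lemma presentation_rel_sym : symmetric presentation_rel.
Proof.
case: (generated_congruenceP S) => _ s _ _ u v.
by apply/asboolP/asboolP; apply: s.
Qed.

Lemma presentation_rel_trans : transitive presentation_rel.
Proof.
case: (generated_congruenceP S) => _ _ t _ v u w /asboolP uv /asboolP vw.
by apply/asboolP; apply: t vw.
Qed.

Canonical presentation_equiv := EquivRel presentation_rel
  presentation_rel_refl presentation_rel_sym presentation_rel_trans.

(* The quotient monoid C^* / ~_S. *)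
Definition presented_monoid : Type := {eq_quot presentation_equiv}.

HB.instance Definition _ := Choice.on presented_monoid.
HB.instance Definition _ := EqQuotient.on presented_monoid.

Definition presented_mul (x y : presented_monoid) : presented_monoid :=
  \pi_presented_monoid ((repr x : W) * repr y).

Definition presented_one : presented_monoid := \pi_presented_monoid (1 : W).

Lemma presented_piP (u v : W) :
  \pi_presented_monoid u = \pi_presented_monoid v <->
  generated_congruence S u v.
Proof.
split=> [/eqmodP /asboolP // | uv].
by apply/eqmodP/asboolP.
Qed.

Lemma presented_mul_pi (u v : W) :
  presented_mul (\pi u) (\pi v) = \pi_presented_monoid (u * v).
Proof.
apply/presented_piP.
case: (generated_congruenceP S) => _ _ _; apply; apply/presented_piP;
  exact: reprK.
Qed.

Lemma presented_mulA : associative presented_mul.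
Proof.
move=> x y z; rewrite -[x]reprK -[y]reprK -[z]reprK.
by rewrite !presented_mul_pi mulgA.
Qed.

Lemma presented_mul1 : left_id presented_one presented_mul.
Proof. by move=> x; rewrite -[x]reprK presented_mul_pi mul1g. Qed.

Lemma presented_mulr1 : right_id presented_one presented_mul.
Proof. by move=> x; rewrite -[x]reprK presented_mul_pi mulg1. Qed.

HB.instance Definition _ := isMonoid.Build presented_monoid
  presented_mulA presented_mul1 presented_mulr1.

Definition presented_letter (c : C) : presented_monoid :=
  \pi_presented_monoid ([:: c] : W).

End Presentation.

Definition monoid_isomorphism (M N : monoidType) (f : M -> N) : Prop :=
  monoid_morphism f /\ bijective f.

(* M is defined by < C | S >, the letter c representing the element g c of M. *)
Definition defined_by (M : monoidType) (C : choiceType)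
    (S : set (free_monoid C * free_monoid C)) (g : C -> M) : Prop :=
  exists2 f : presented_monoid S -> M,
    monoid_isomorphism f & forall c, f (presented_letter S c) = g c.

(* The chain 1 < ... < n is rendered by 'I_n, whose elements are 0, ..., n - 1:
   the point x of the chain is the ordinal of value x - 1. *)
Definition transformation (n : nat) : Type := {ffun 'I_n -> 'I_n}.

Section Transformation.
Variable n : nat.

HB.instance Definition _ := Finite.copy (transformation n) {ffun 'I_n -> 'I_n}.

(* app a x is x acted on by a on the right; tmul composes from left to right. *)
Definition app (a : transformation n) : 'I_n -> 'I_n :=
  (a : {ffun 'I_n -> 'I_n}).

Definition tmul (a b : transformation n) : transformation n :=
  [ffun x => app b (app a x)].

Definition tone : transformation n := [ffun x => x].

Lemma tmulE a b x : app (tmul a b) x = app b (app a x).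
Proof. by rewrite /app ffunE. Qed.

Lemma toneE x : app tone x = x.
Proof. by rewrite /app ffunE. Qed.

Lemma appP (a b : transformation n) : app a =1 app b -> a = b.
Proof. by move=> ab; apply/ffunP. Qed.

Lemma tmulA : associative tmul.
Proof. by move=> a b c; apply: appP => x; rewrite !tmulE. Qed.

Lemma tmul1 : left_id tone tmul.
Proof. by move=> a; apply: appP => x; rewrite tmulE toneE. Qed.

Lemma tmulr1 : right_id tone tmul.
Proof. by move=> a; apply: appP => x; rewrite tmulE toneE. Qed.

HB.instance Definition _ :=
  isMonoid.Build (transformation n) tmulA tmul1 tmulr1.

Definition order_preserving (a : transformation n) : bool :=
  [forall x : 'I_n, forall y : 'I_n, (x <= y) ==> (app a x <= app a y)].

Definition interval_image (a : transformation n) : bool :=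
  [forall x : 'I_n, forall y : 'I_n, forall z : 'I_n,
    [&& x <= y, y <= z, x \in codom (app a) & z \in codom (app a)] ==>
      (y \in codom (app a))].

Definition extensive (a : transformation n) : bool :=
  [forall x : 'I_n, x <= app a x].

Definition in_IO : pred (transformation n) :=
  fun a => order_preserving a && interval_image a.

Definition in_IOplus : pred (transformation n) :=
  fun a => in_IO a && extensive a.

Lemma order_preservingP a :
  reflect (forall x y : 'I_n, x <= y -> app a x <= app a y)
          (order_preserving a).
Proof.
by apply: (iffP forallP) => h x; [move=> y; apply/implyP; move: y; apply/forallP
  | apply/forallP => y; apply/implyP; exact: h].
Qed.

Lemma interval_imageP a :
  reflect (forall x y z : 'I_n, x <= y -> y <= z ->
             x \in codom (app a) -> z \in codom (app a) ->
             y \in codom (app a))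
          (interval_image a).
Proof.
apply: (iffP forallP) => h x.
  move=> y z xy yz xa za; have /forallP/(_ y)/forallP/(_ z)/implyP := h x.
  by apply; rewrite xy yz xa za.
apply/forallP => y; apply/forallP => z; apply/implyP => /and4P[].
exact: h.
Qed.

Lemma in_IO_closed : monoid_closed in_IO.
Proof.
split=> [|a b /andP[/order_preservingP oa /interval_imageP ia]
              /andP[/order_preservingP ob /interval_imageP ib]].
  apply/andP; split; first by apply/order_preservingP => x y; rewrite !toneE.
  by apply/interval_imageP => x y z _ _ _ _; apply/codomP; exists y; rewrite toneE.
apply/andP; split.
  by apply/order_preservingP => x y xy; rewrite !tmulE; apply/ob/oa.
apply/interval_imageP => x y z xy yz /codomP[x' xE] /codomP[z' zE].
rewrite tmulE in xE; rewrite tmulE in zE.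
have /codomP[w yE] : y \in codom (app b).
  by apply: (ib x y z) => //; rewrite ?xE ?zE codom_f.
have [xw|/ltnW wx] := leqP (app a x') w; last first.
  apply/codomP; exists x'; rewrite tmulE -xE; apply/val_inj/eqP.
  by rewrite eqn_leq xy andbT yE xE ob.
have [wz|/ltnW zw] := leqP w (app a z'); last first.
  apply/codomP; exists z'; rewrite tmulE -zE; apply/val_inj/eqP.
  by rewrite eqn_leq yz /= yE zE ob.
have /codomP[w' wE] : w \in codom (app a).
  by apply: ia xw wz _ _; rewrite codom_f.
by apply/codomP; exists w'; rewrite tmulE -wE.
Qed.

Lemma in_IOplus_closed : monoid_closed in_IOplus.
Proof.
split=> [|a b /andP[IOa /forallP ea] /andP[IOb /forallP eb]].
  apply/andP; split; first exact: in_IO_closed.1.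
  by apply/forallP => x; rewrite toneE.
apply/andP; split; first exact: in_IO_closed.2.
by apply/forallP => x; rewrite tmulE; apply: leq_trans (ea x) (eb _).
Qed.

Definition IOplus : Type := {a : transformation n | in_IOplus a}.

HB.instance Definition _ := SubChoice.on IOplus.
HB.instance Definition _ :=
  SubChoice_isSubMonoid.Build (transformation n) in_IOplus IOplus
    in_IOplus_closed.

(* The letters b_1, ..., b_(n-1); idx b_i = i. *)
Definition letter : Type := 'I_n.-1.
HB.instance Definition _ := Finite.copy letter 'I_n.-1.

Definition idx (b : letter) : nat := (nat_of_ord b).+1.

(* The transformation represented by b. The ordinal x stands for the point
   x.+1 of the chain, hence the test x.+1 <= idx b. By shiftE, the default
   value of insubd is never used. *)
Definition shift (b : letter) : transformation n :=
  [ffun x : 'I_n => if x.+1 <= idx b then insubd x x.+1 else x].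

Lemma shiftE b x :
  app (shift b) x = (if x.+1 <= idx b then x.+1 else x) :> nat.
Proof.
rewrite /app ffunE; case: ifP => // xb.
rewrite val_insubd; case: ifP => // /negbT; rewrite -leqNgt => nx.
have := ltn_ord b; rewrite ltn_predRL => bn.
by have := leq_ltn_trans xb bn; rewrite ltnNge nx.
Qed.

Lemma shift_in_IOplus b : in_IOplus (shift b).
Proof.
apply/andP; split; last first.
  by apply/forallP => x; rewrite shiftE; case: ifP.
apply/andP; split.
  apply/order_preservingP => x y xy; rewrite !shiftE.
  case: ifP => xb; case: ifP => yb //; last exact: leqW.
  by rewrite ltn_neqAle xy andbT; apply: contraFneq yb => <-.
(* the image of b_i is {2, ..., n} *)
have im (y : 'I_n) : (y \in codom (app (shift b))) = (0 < y).
  apply/codomP/idP => [[x ->]|y0].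
    by rewrite shiftE; case: ifP => //; case: (nat_of_ord x).
  have [yb|by_] := leqP y (idx b); last first.
    by exists y; apply/val_inj; rewrite /= shiftE ltnNge (ltnW by_).
  have lt : y.-1 < n by apply: leq_ltn_trans (leq_pred _) (ltn_ord y).
  by exists (Ordinal lt); apply/val_inj; rewrite /= shiftE /= prednK // yb.
by apply/interval_imageP => x y z xy _; rewrite !im => x0 _; apply: leq_trans xy.
Qed.

Definition represented (b : letter) : IOplus :=
  exist in_IOplus (shift b) (shift_in_IOplus b).

Let word := free_monoid letter.

(* b_i b_1 = b_i *)
Definition R3 : set (word * word) :=
  [set p | exists bi b1 : letter,
     idx b1 = 1%N /\ p = ([:: bi; b1], [:: bi])].

(* b_i b_(j+1) = b_(j+1) b_(i+1), for 1 <= i <= j <= n - 2 *)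
Definition R4 : set (word * word) :=
  [set p | exists (j : nat) (bi bj1 bi1 : letter),
     [/\ idx bi <= j <= n - 2, idx bj1 = j.+1, idx bi1 = (idx bi).+1
       & p = ([:: bi; bj1], [:: bj1; bi1])]].

Definition Rplus : set (word * word) := R3 `|` R4.

End Transformation.

Arguments R3 n : clear implicits.
Arguments R4 n : clear implicits.
Arguments Rplus n : clear implicits.

(* Main.v *)
(* Rewriting b_j b_1 -> b_j and b_j b_i -> b_(i-1) b_j (2 <= i <= j), which is what
   the relations allow for the pairs i <= j, turns every word into one with
   strictly increasing indices.  An element of IO_n^+ is determined by the set of
   those i at which it identifies i and i + 1, because it fixes n and its other
   steps have height 1; the increasing word b_(i_1) ... b_(i_k) represents the
   element whose set is {i_1, ..., i_k}.  So increasing words are normal forms. *)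

Require Import Defs.
From mathcomp Require Import all_boot.
From mathcomp Require Import boolp classical_sets cardinality.
From mathcomp Require Import zify.

Local Open Scope classical_set_scope.
Local Open Scope card_scope.

Set Implicit Arguments.
Unset Strict Implicit.
Unset Printing Implicit Defensive.

(** * Cardinality of an injective image *)

Lemma card_eq_image_finpred (T : finType) (U : Type) (P : pred T) (f : T -> U) :
  {in P &, injective f} -> [set f x | x in [set` P]] #= `I_#|P|.
Proof.
move=> f_inj.
have -> : [set f x | x in [set` P]] = [set f (enum_val i) | i in @setT 'I_#|P|].
  apply/seteqP; split=> _ [x xP <-]; last by exists (enum_val x); first exact: enum_valP.
  by exists (enum_rank_in xP x) => //; rewrite enum_rankK_in.
have -> : `I_#|P| = [set val i | i in @setT 'I_#|P|].
  apply/seteqP; split=> [i /= lt_i | _ [i _ <-] /=]; last exact: ltn_ord.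
  by exists (Ordinal lt_i).
apply: (card_eq_trans (inj_card_eq _)).
  by move=> i j _ _ /f_inj e; apply/enum_val_inj/e; exact: enum_valP.
by rewrite card_eq_sym; apply: inj_card_eq => i j _ _; exact: val_inj.
Qed.

(** * Presentations obtained from normal forms *)

Section NormalForms.
Variables (M : monoidType) (C : choiceType) (g : C -> M).
Local Open Scope group_scope.

Definition eval (u : free_monoid C) : M := foldr (fun c m => g c * m) 1 u.

Lemma evalM (u v : free_monoid C) : eval (u * v) = eval u * eval v.
Proof. by elim: u => [|c u IHu] /=; rewrite ?mul1g // IHu mulgA. Qed.

Variable S : set (free_monoid C * free_monoid C).
Hypothesis eval_S : forall p, S p -> eval p.1 = eval p.2.

(** The kernel of [eval] is a congruence containing [S]. *)
Lemma eval_generated_congruence (u v : free_monoid C) :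
  generated_congruence S u v -> eval u = eval v.
Proof.
move=> /(_ (fun u v => eval u = eval v)); apply=> //; split=> // [u1 u2 u3 -> // | u1 u2 v1 v2 eu ev].
by rewrite !evalM eu ev.
Qed.

Variable nf : M -> free_monoid C.
Hypothesis nfK : cancel nf eval.
Hypothesis nf_congruent : forall u, generated_congruence S u (nf (eval u)).

Local Open Scope quotient_scope.

(** [eval] factors through the quotient, and sending m to the class of [nf m] inverts it: [nfK]
    gives one side, [nf_congruent] the other. *)
Lemma defined_by_normal_forms : defined_by S g.
Proof.
pose f (x : presented_monoid S) : M := eval (repr x).
have f_pi u : f (\pi u) = eval u.
  by apply/eval_generated_congruence/presented_piP; rewrite reprK.
exists f; last by move=> c; rewrite f_pi /= mulg1.
split.
  split; first exact: f_pi.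
  move=> x y; rewrite -[x]reprK -[y]reprK.
  by rewrite [X in f X]presented_mul_pi !f_pi evalM.
exists (fun m => \pi_(presented_monoid S) (nf m : free_monoid C)) => [x | m]; last by rewrite f_pi nfK.
rewrite -[RHS]reprK; apply/presented_piP.
by case: (generated_congruenceP S) => _ s _ _; apply: s; exact: nf_congruent.
Qed.

End NormalForms.

(** * Indexing and counting the relations *)

Section Relations.
Variable n : nat.
Implicit Types b c l m : letter n.

(** The truncated predecessor sends b_1 to itself; [pair_relation] treats b_1 separately. *)
Definition prev_letter b : letter n :=
  Ordinal (leq_ltn_trans (leq_pred b) (ltn_ord b)).

(* The relation with side b_j b_i, for p = (b_i, b_j) with i <= j: it is
   b_j b_1 = b_j when i = 1, and b_(i-1) b_j = b_j b_i otherwise. *)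
Definition pair_relation (p : letter n * letter n) :
    free_monoid (letter n) * free_monoid (letter n) :=
  if p.1 == 0 :> nat then ([:: p.2; p.1], [:: p.2])
  else ([:: prev_letter p.1; p.2], [:: p.2; p.1]).

Definition letter_pair : pred (letter n * letter n) :=
  fun p => nat_of_ord p.1 <= nat_of_ord p.2.

(** Pairs with i = 1 give [R3]; the relation of [R4] with parameters i and j comes from the pair
    (b_(i+1), b_(j+1)). *)
Lemma RplusE : Rplus n = [set pair_relation p | p in [set` letter_pair]].
Proof.
apply/seteqP; split=> [_ [[bi [b1 [b1E ->]]] | [j [bi [bj [bi' [ij bjE bi'E ->]]]]]] |].
- have b0 : b1 = 0 :> nat by case: b1E.
  by exists (b1, bi); rewrite /= ?unfold_in /letter_pair /pair_relation /= b0.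
- move: ij bjE bi'E; rewrite /idx => /andP[ij _] [bjE] [bi'E].
  exists (bi', bj); first by rewrite /= unfold_in /letter_pair /= bi'E bjE.
  rewrite /pair_relation /= bi'E /=; congr ([:: _; _], _).
  by apply/val_inj; rewrite /= bi'E.
move=> _ [[b c] /= bc <-]; rewrite unfold_in /letter_pair /= in bc.
rewrite /pair_relation /=; case: ifPn => [/eqP b0 | b0].
  by left; exists c, b; rewrite /idx b0.
right; exists c, (prev_letter b), c, b; rewrite /idx /=.
have := ltn_ord c; split=> //; lia.
Qed.

Lemma pair_relation_inj : injective pair_relation.
Proof.
move=> [b c] [b' c']; rewrite /pair_relation /=.
(* Right sides of lengths 1 and 2 separate the two kinds; within a kind, the side b_j b_i determines
   the pair. *)
by case: ifP => _; case: ifP => _ //; [case=> -> -> | case=> _ _ -> ->].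
Qed.

(** Summing over the larger entry gives 1 + ... + (n - 1), a binomial coefficient. *)
Lemma card_letter_pair : #|letter_pair| = (n ^ 2 - n) %/ 2.
Proof.
rewrite -sum1_card -(pair_big_dep xpredT (fun i j : 'I_n.-1 => i <= j) (fun _ _ => 1)) /=.
rewrite (exchange_big_dep xpredT) //=.
have -> : \sum_(j < n.-1) \sum_(i < n.-1 | i <= j) 1 = \sum_(j < n.-1) j.+1.
  apply: eq_bigr => j _; rewrite (big_ord_narrow (ltn_ord j)).
  by rewrite sum1_card card_ord.
have -> : \sum_(j < n.-1) j.+1 = \sum_(0 <= i < n.-1.+1) i.
  by rewrite big_mkord big_ord_recl.
rewrite bin2_sum bin2 divn2; congr _./2.
by case: n => // k; rewrite -mulnn mulnS addKn.
Qed.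

Lemma card_Rplus : Rplus n #= `I_((n ^ 2 - n) %/ 2).
Proof.
rewrite RplusE -card_letter_pair.
by apply: card_eq_image_finpred => p q _ _; exact: pair_relation_inj.
Qed.

(** * Rewriting words to increasing ones *)

Local Open Scope group_scope.

Local Notation "u ~ v" := (generated_congruence (Rplus n) u v) (at level 70).

(* Replacing l by l - 1 leaves room for the letter b_(i-1) moved to the front. *)
Lemma Rplus_insert m (s : free_monoid (letter n)) (l : nat) :
  path ltn l (map (@idx n) s) -> l <= idx m ->
  exists2 t : free_monoid (letter n), path ltn l.-1 (map (@idx n) t)
    & ([:: m] : free_monoid (letter n)) * s ~ t.
Proof.
have [er es et em] := generated_congruenceP (Rplus n).
elim: s m l => [|i s IHs] m l /= => [_ lm | /andP[li pis] lm].
  by exists [:: m] => //=; rewrite andbT; move: lm; rewrite /idx; lia.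
have [mi | im] := ltnP m i.
  exists [:: m, i & s] => //=; rewrite pis /idx !andbT; move: lm; rewrite /idx; lia.
have rel : (pair_relation (i, m)).1 ~ (pair_relation (i, m)).2.
  by move=> e _; apply; rewrite RplusE; exists (i, m).
rewrite /pair_relation /= in rel.
(* Whether b_i is absorbed (i = 1) or passes to the front as b_(i-1), [m] must next be inserted into
   [s]. The letters of [t] then exceed i - 1, so b_(i-1) may precede them. *)
have [t tP st] := IHs m (idx i) pis im.
case: ifP rel => [/eqP i0 | i0] /= rel.
  exists t.
    by move: tP li; rewrite /idx i0 ltnS leqn0 => ? /eqP->.
  by apply: et st; apply: (em _ _ _ _ rel (er s)).
exists (prev_letter i :: t).
  have idx_prev : idx (prev_letter i) = (idx i).-1 by rewrite /idx /= prednK ?lt0n ?i0.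
  rewrite /= idx_prev tP andbT.
  by move: li i0; rewrite /idx; lia.
apply: (et _ ([:: prev_letter i; m] ++ s)).
  by apply: (em _ _ _ _ (es _ _ rel) (er s)).
exact: (em _ _ _ _ (er [:: prev_letter i]) st).
Qed.

Lemma Rplus_sorted (u : free_monoid (letter n)) :
  exists2 t : free_monoid (letter n), sorted ltn (map (@idx n) t) & u ~ t.
Proof.
have [er es et em] := generated_congruenceP (Rplus n).
(* The lower bound 0 survives every insertion, since [0.-1] is 0. *)
suff [t /path_sorted] : exists2 t : free_monoid (letter n),
    path ltn 0 (map (@idx n) t) & u ~ t by exists t.
elim: u => [|m u [t tP ut]]; first by exists [::].
have [t' t'P tt'] := Rplus_insert tP (leq0n (idx m)).
exists t' => //; apply: et tt'; exact: (em _ _ _ _ (er [:: m]) ut).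
Qed.

End Relations.

(** * The action on the chain *)

Section Action.
Variable n : nat.
Implicit Types (a : IOplus n) (b c : letter n) (x y : 'I_n).

Definition act a x : 'I_n := app (val a) x.

Lemma actM a a' x : act (a * a')%g x = act a' (act a x).
Proof. exact: tmulE. Qed.

Lemma act1 x : act 1%g x = x.
Proof. exact: toneE. Qed.

Lemma act_represented b x :
  act (represented b) x = (if x <= b then x.+1 else x) :> nat.
Proof. exact: shiftE. Qed.

Lemma act_inj a a' : act a =1 act a' -> a = a'.
Proof. by move=> aa'; apply/val_inj/Defs.appP. Qed.

Lemma act_homo a x y : x <= y -> act a x <= act a y.
Proof. by have /andP[/andP[/order_preservingP h _] _] := valP a; exact: h. Qed.

Lemma act_ge a x : x <= act a x.
Proof. by have /andP[_ /forallP] := valP a; exact. Qed.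

Lemma act_max a x : x.+1 = n -> act a x = x.
Proof.
move=> xn; apply/val_inj/eqP => /=.
by rewrite eqn_leq act_ge andbT -ltnS xn ltn_ord.
Qed.

(** A larger step would skip the value just above [act a x]. That value has a preimage because the
    image is an interval, but monotonicity excludes preimages both up to [x] and from [y] on. *)
Lemma act_step a x y : y = x.+1 :> nat ->
  act a y = act a x + (act a x != act a y) :> nat.
Proof.
move=> yx; have axy : act a x <= act a y by apply: act_homo; rewrite yx.
have [-> | ne] /= := eqVneq (act a x); first by rewrite addn0.
have lt_axy : act a x < act a y by rewrite ltn_neqAle axy andbT.
rewrite addn1; apply/eqP; rewrite eqn_leq lt_axy andbT leqNgt.
apply/negP => gap; have zn := leq_ltn_trans lt_axy (ltn_ord (act a y)).
have /andP[/andP[_ /interval_imageP imP] _] := valP a.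
have /codomP[w wE] : Ordinal zn \in codom (app (val a)).
  by apply: (imP (act a x) _ (act a y)) => //; exact: codom_f.
have {}wE : act a w = (act a x).+1 :> nat by rewrite /act -wE.
have [wx | xw] := leqP w x.
  by have := act_homo a wx; rewrite wE ltnn.
by move: gap; rewrite -wE ltnNge act_homo // yx.
Qed.

(** * Collapsed pairs and increasing words *)

Definition left_point b : 'I_n := widen_ord (leq_pred n) b.

Lemma right_point_subproof b : b.+1 < n.
Proof. by rewrite -ltn_predRL. Qed.

Definition right_point b : 'I_n := Ordinal (right_point_subproof b).

(** For the letter b_i, the two points are i and i + 1 of the chain. *)
Definition collapses a b : bool := act a (left_point b) == act a (right_point b).

Lemma collapses_inj a a' : collapses a =1 collapses a' -> a = a'.
Proof.
move=> aa'; apply: act_inj => x.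
(* Induction downwards from the greatest point, which every element fixes; [collapses] decides
   whether each step has height 0 or 1. *)
have [k] := ubnP (n - x); elim: k x => // k IHk x xk.
have [xn | nx] := leqP n x.+1.
  by rewrite !act_max //; apply/eqP; rewrite eqn_leq xn ltn_ord.
have xn1 : x < n.-1 by rewrite ltn_predRL.
pose b : letter n := Ordinal xn1.
have -> : x = left_point b by apply/val_inj.
have /(congr1 val) /= : act a (right_point b) = act a' (right_point b).
  by apply: IHk => /=; lia.
have step : right_point b = (left_point b).+1 :> nat by [].
rewrite (act_step a step) (act_step a' step) -!/(collapses _ b) aa' => /addIn.
exact: val_inj.
Qed.

Lemma collapses_eval_sorted (s : free_monoid (letter n)) b :
  sorted ltn (map (@idx n) s) ->
  collapses (eval (@represented n) s) b = (b \in (s : seq (letter n))).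
Proof.
elim: s b => [|c s IHs] b /=.
  by move=> _; rewrite /collapses !act1 -val_eqE /= ltn_eqF.
rewrite (path_sortedE ltn_trans) => /andP[/allP cs ss]; rewrite in_cons.
rewrite /collapses !actM.
(* The first factor [c] shifts both points of [b] if b < c, fixes both if b > c, and merges them if
   b = c. After a shift the question concerns b + 1, which is at most [c] and so does not occur in
   [s]. *)
have [bc | cb | bc] := ltngtP b c.
- have bn : b.+1 < n.-1 by apply: leq_ltn_trans bc (ltn_ord c).
  pose b' : letter n := Ordinal bn.
  have -> : act (represented c) (left_point b) = left_point b'.
    by apply/val_inj; rewrite /= act_represented /= (ltnW bc).
  have -> : act (represented c) (right_point b) = right_point b'.
    by apply/val_inj; rewrite /= act_represented /= bc.
  rewrite -/(collapses _ b') IHs // -val_eqE /= ltn_eqF //=.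
  have no (d : letter n) : d <= c -> (d \in (s : seq (letter n))) = false.
    by move=> dc; apply/negP => /(map_f (@idx n)) /cs; rewrite /= /idx ltnNge ltnS dc.
  by rewrite !no //= ltnW.
- have -> : act (represented c) (left_point b) = left_point b.
    by apply/val_inj; rewrite /= act_represented /= leqNgt cb.
  have -> : act (represented c) (right_point b) = right_point b.
    by apply/val_inj; rewrite /= act_represented /= ltnNge (ltnW cb).
  by rewrite -/(collapses _ b) IHs // -val_eqE /= gtn_eqF.
have -> : b = c by apply/val_inj.
rewrite eqxx /=; apply/eqP; congr (act _ _); apply/val_inj.
by rewrite /= !act_represented /= leqnn ltnn.
Qed.

(** The normal form of [a]; [enum] lists the letters in increasing order. *)
Definition collapse_word a : free_monoid (letter n) :=
  [seq b <- enum 'I_n.-1 | collapses a b].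

Lemma collapse_word_sorted a : sorted ltn (map (@idx n) (collapse_word a)).
Proof.
rewrite sorted_map; apply: sorted_filter; first by move=> y x z /=; exact: ltn_trans.
have := iota_ltn_sorted 0 n.-1; rewrite -val_enum_ord sorted_map; exact: sub_sorted.
Qed.

Lemma mem_collapse_word a b : (b \in (collapse_word a : seq (letter n))) = collapses a b.
Proof. by rewrite mem_filter mem_enum andbT. Qed.

Lemma collapse_wordK : cancel collapse_word (eval (@represented n)).
Proof.
move=> a; apply: collapses_inj => b.
by rewrite collapses_eval_sorted ?collapse_word_sorted // mem_collapse_word.
Qed.

(** An increasing word is determined by its set of letters. *)
Lemma collapse_word_eval (s : free_monoid (letter n)) :
  sorted ltn (map (@idx n) s) -> collapse_word (eval (@represented n) s) = s.
Proof.
move=> ss; apply: (@irr_sorted_eq _ (relpre (@idx n) ltn)).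
- by move=> y x z /=; exact: ltn_trans.
- by move=> x /=; exact: ltnn.
- by rewrite -sorted_map; exact: collapse_word_sorted.
- by rewrite -sorted_map.
by move=> b; rewrite mem_collapse_word collapses_eval_sorted.
Qed.

Lemma eval_Rplus p : Rplus n p -> eval (@represented n) p.1 = eval (@represented n) p.2.
Proof.
rewrite RplusE => -[[b c] /= bc <-]; rewrite unfold_in /letter_pair /= in bc.
rewrite /pair_relation /=; apply: act_inj => x; apply/val_inj.
case: ifP => b0 /=; rewrite !mulg1 !(actM, act_represented) /=;
  repeat case: ifP; lia.
Qed.

(** [u] is congruent to an increasing word, which has the same value and is the normal form of that
    value. *)
Lemma collapse_word_congruent (u : free_monoid (letter n)) :
  generated_congruence (Rplus n) u (collapse_word (eval (@represented n) u)).
Proof.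
have [t ts ut] := Rplus_sorted u.
by rewrite (eval_generated_congruence eval_Rplus ut) collapse_word_eval.
Qed.

End Action.

Theorem mainTheorem6 (n : nat) (hn : (1 <= n)%N) :
  [/\ #|{: letter n}| = (n - 1)%N,
      Rplus n #= `I_((n ^ 2 - n) %/ 2)
    & defined_by (Rplus n) (@represented n)].
Proof.
split; first by rewrite subn1; exact: card_ord.
  exact: card_Rplus.
exact: (defined_by_normal_forms (@eval_Rplus n) (@collapse_wordK n)
  (@collapse_word_congruent n)).
Qed.
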